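(* Let $\ell$ be an odd prime. Assume that the number of primes $p\in S^1(\ell,T)$ that are essential for $\Phi_\ell(X)$ is $o(T)$ as $T\to\infty$. Then $|S^2(\ell,T)|=o(T)$ as $T\to\infty$.
   Context: $\Phi_\ell(X)$ denotes the $\ell$-th cyclotomic polynomial. For a natural number $n$, $R_\ell(n):=\min\{d\in\mathbb{N}: n\mid \Phi_\ell(d)\}$ if such $d$ exists, and $R_\ell(n)=\infty$ otherwise. $\mathbb{P}$ denotes the set of primes $p$ that divide $\Phi_\ell(d)$ for some $d\in\mathbb{N}$. For a positive integer $i$ and real $T$, $S^i(\ell,T):=\{p\in\mathbb{P}: R_\ell(p^i)\le T\}$. A prime $p$ is called essential for $\Phi_\ell(X)$ if for every integer $c$ with $|cp|<\Phi_\ell(p^{2/\ell})$ the polynomial $\Phi_\ell(X)-cp$ is irreducible over $\mathbb{Q}$. *)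

(* Defs.v *)
From HB Require Import structures.
From mathcomp Require Import all_boot all_order all_algebra all_field.
From mathcomp Require Import boolp reals Rstruct exp.
Set Implicit Arguments. Unset Strict Implicit. Unset Printing Implicit Defensive.
Import Order.TTheory GRing.Theory Num.Theory.
Local Open Scope ring_scope.

Notation R := Rdefinitions.R.

Definition PhiZ (l : nat) (d : int) : int := ('Phi_l).[d].

Definition PhiR (l : nat) (x : R) : R := (map_poly (fun z : int => z%:~R) 'Phi_l).[x].

Definition is_R (l n d : nat) : Prop :=
  (0 < d)%N /\ (n%:Z %| PhiZ l d%:Z)%Z /\
  (forall d' : nat, (0 < d')%N -> (d' < d)%N -> ~ (n%:Z %| PhiZ l d'%:Z)%Z).

(* R_l(n) <= T   (false when R_l(n) = infinity) *)
Definition R_le (l n : nat) (T : R) : Prop :=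
  exists d : nat, is_R l n d /\ d%:R <= T.

Definition in_S (i l : nat) (T : R) (p : nat) : Prop :=
  prime p /\ R_le l (p ^ i) T.

Definition essential (l p : nat) : Prop :=
  forall c : int, `|(c * p%:Z)%:~R : R| < PhiR l (p%:R `^ (2 / l%:R)) ->
    irreducible_poly (map_poly (intr : int -> rat) 'Phi_l - ((c * p%:Z)%:~R)%:P).

(* Bound: any p in S^i(l,T) with i >= 1 satisfies p <= Phi_l(d) <= Phi_l(floor T). *)
Definition S_bound (l : nat) (T : R) : nat := (absz (PhiZ l (Num.truncn T)%:Z)).+1.

Definition count_S (i l : nat) (T : R) (Q : nat -> Prop) : nat :=
  \sum_(p < S_bound l T) (asbool (in_S i l T p /\ Q p) : nat).

Definition little_o_T (f : R -> R) : Prop :=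
  forall eps : R, 0 < eps -> exists T0 : R, forall T : R, T0 <= T -> `|f T| <= eps * T.

(* Main.v *)
(** Put n = l - 1 and let p be a non-essential prime with p^2 | Phi(d), d <= T:
    Phi - cp = A B over Z with A monic, 0 < deg A < n, and |cp| < Phi(p^(2/l)).
    Let s be the sum of the roots of A, an integer. Modulo p the polynomial Phi
    splits as the product of the X - d^i (1 <= i <= n), so s = \sum_(i in I) d^i
    mod p for a nonempty proper subset I, and p divides the resultant of Phi and
    s - \sum_(i in I) X^i. This resultant is nonzero, as the powers zeta^i form a
    basis of Q(zeta) in which s has constant coordinates, and it is polynomially
    bounded in s, so it has a bounded number of prime factors p with p^2 >= T. The
    roots of Phi - cp are O(p^(2/l)), and p^2 <= Phi(d) <= (T + 1)^(l - 1), so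
    there are only O(T^(1 - 1/l)) possible pairs (I, s). At most T^(1/2) primes
    satisfy p^2 <= T. *)
Require Import Defs.
From HB Require Import structures.
From mathcomp Require Import all_boot all_order all_algebra all_field.
From mathcomp Require Import boolp reals Rstruct exp.
From mathcomp Require Import perm zify ring lra.
Import Order.TTheory GRing.Theory Num.Theory.
Local Open Scope ring_scope.

Set Implicit Arguments.
Unset Strict Implicit.
Unset Printing Implicit Defensive.

(** * Cyclotomic polynomials of prime index *)

Lemma Cyclotomic_prime (l : nat) : prime l -> 'Phi_l = \sum_(i < l) 'X^i.
Proof.
move=> pr_l; apply: (@mulfI _ ('X - 1)); first by rewrite -size_poly_eq0 size_XsubC.
have l_gt0 := prime_gt0 pr_l; rewrite -subrX1 -prod_Cyclotomic //.
have -> : divisors l = [:: 1%N; l].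
  apply: (irr_sorted_eq ltn_trans ltnn); rewrite ?sorted_divisors_ltn //=.
    by rewrite prime_gt1.
  move=> d; rewrite -dvdn_divisors // !inE; apply/idP/orP.
    by move=> d_l; apply/orP; case/primeP: pr_l => _; apply.
  by case=> /eqP->; rewrite ?dvd1n.
rewrite !big_cons big_nil mulr1; congr (_ * _).
by have := prod_Cyclotomic (isT : 0 < 1)%N; rewrite big_cons big_nil mulr1 expr1.
Qed.

Lemma size_Cyclotomic_prime (l : nat) : prime l -> size 'Phi_l = l.
Proof.
by move=> pr_l; rewrite size_Cyclotomic totient_prime // prednK ?prime_gt0.
Qed.

Lemma coef_Cyclotomic_prime (l i : nat) : prime l -> ('Phi_l)`_i = (i < l)%N%:R.
Proof.
move=> pr_l; rewrite Cyclotomic_prime // coef_sum.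
under eq_bigr do rewrite coefXn.
case: ltnP => [lt_il | le_li].
  rewrite (bigD1 (Ordinal lt_il)) //= eqxx big1 ?addr0 // => j.
  by rewrite -val_eqE /= eq_sym => /negPf->.
by rewrite big1 // => j _; rewrite gtn_eqF // (leq_trans (ltn_ord j)).
Qed.

Lemma horner_map_Cyclotomic_prime (A : nzRingType) (l : nat) (x : A) : prime l ->
  (map_poly intr 'Phi_l).[x] = \sum_(i < l) x ^+ i.
Proof.
move=> pr_l; rewrite Cyclotomic_prime // raddf_sum horner_sum.
by apply: eq_bigr => i _; rewrite /= map_polyXn hornerXn.
Qed.

(** * Size of resultants and products of distinct primes *)

Lemma resultant_coef_bound (p q : {poly int}) (B : nat) :
  (forall i, `|p`_i| <= B%:Z) -> (forall i, `|q`_i| <= B%:Z) ->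
  let N := ((size q).-1 + (size p).-1)%N in
  `|resultant p q| <= (N`! * B ^ N)%N%:Z.
Proof.
move=> pB qB; cbv zeta; set N := (_ + _)%N; apply: le_trans (ler_norm_sum _ _ _) _.
(* The bound is put in the shape of the Leibniz expansion of the Sylvester determinant, each entry
   of which is a coefficient or 0. *)
have -> : (N`! * B ^ N)%N%:Z = \sum_(s : 'S_N) \prod_(i < N) B%:Z.
  by rewrite sumr_const card_Sn prodr_const card_ord -mulr_natl PoszM -!natz natrX.
apply: ler_sum => s _; rewrite normrM normrX normrN1 expr1n mul1r normr_prod.
apply: ler_prod => i _; rewrite normr_ge0 Sylvester_mxE.
by case: split => j; case: leqP => _; rewrite ?mulr1n ?mulr0n ?normr0 ?lez0n //=.
Qed.

Lemma prod_primes_dvdn (s : seq nat) (M : nat) :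
  uniq s -> {in s, forall p, prime p /\ (p %| M)%N} -> (\prod_(p <- s) p %| M)%N.
Proof.
elim: s => [|p s IHs] /=; first by rewrite big_nil.
case/andP=> p_s us hs; rewrite big_cons Gauss_dvd.
  have [_ ->] := hs p (mem_head _ _).
  by rewrite IHs // => q qs; apply: hs; rewrite inE qs orbT.
have [pr_p _] := hs p (mem_head _ _).
rewrite prime_coprime // Euclid_dvd_prod // big_has; apply/hasPn => q qs.
have [|pr_q _] := hs q; first by rewrite inE qs orbT.
by rewrite dvdn_prime2 //; apply: contraNneq p_s => ->.
Qed.

(** * Subset-sum polynomials and their resultant with ['Phi_l] *)

(** Vanishing at [z] says that [s] is a subset sum of the powers of [z]. The index [i] stands for
    the exponent [i.+1], so for [n = l.-1] the exponents are 1, ..., l - 1. *)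
Definition subset_sum_poly (n : nat) (I : {set 'I_n}) (s : int) : {poly int} :=
  s%:P - \sum_(i in I) 'X^(i.+1).

Lemma coef0_subset_sum_poly (n : nat) (I : {set 'I_n}) (s : int) :
  (subset_sum_poly I s)`_0 = s.
Proof.
by rewrite coefB coefC coef_sum big1 ?subr0 // => i _; rewrite coefXn.
Qed.

Lemma coefS_subset_sum_poly (n : nat) (I : {set 'I_n}) (s : int) (i : 'I_n) :
  (subset_sum_poly I s)`_i.+1 = - (i \in I)%:R.
Proof.
rewrite coefB coefC coef_sum sub0r; congr (- _).
under eq_bigr do rewrite coefXn eqSS.
have [iI | iI] := boolP (i \in I).
  rewrite (bigD1 i) //= eqxx big1 ?addr0 // => j /andP[_].
  by rewrite -val_eqE eq_sym => /negPf->.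
rewrite big1 // => j jI; case: eqP => // /val_inj ij.
by rewrite ij jI in iI.
Qed.

Lemma size_subset_sum_poly (n : nat) (I : {set 'I_n}) (s : int) :
  (size (subset_sum_poly I s) <= n.+1)%N.
Proof.
rewrite (leq_trans (size_polyD _ _)) // geq_max (leq_trans (size_polyC_leq1 _)) //.
rewrite size_polyN (leq_trans (size_sum _ _ _)) //.
by elim/big_ind: _ => // [x y|i _]; rewrite ?geq_max ?size_polyXn ?ltnS ?ltn_ord => // -> ->.
Qed.

Lemma subset_sum_poly_coef_bound (n : nat) (I : {set 'I_n}) (s : int) (j : nat) :
  `|(subset_sum_poly I s)`_j| <= (`|s|.+1)%N%:Z.
Proof.
case: j => [|j]; first by rewrite coef0_subset_sum_poly -abszE lez_nat leqnSn.
have [lt_jn | le_nj] := ltnP j n.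
  by rewrite (coefS_subset_sum_poly I s (Ordinal lt_jn)); case: (_ \in _).
by rewrite nth_default ?normr0 // (leq_trans (size_subset_sum_poly I s)).
Qed.

(** ['Phi_n] is the minimal polynomial of [z] over the rationals, and divisibility passes between
    rational and integer polynomials. *)
Lemma Cyclotomic_dvdp_root (n : nat) (z : algC) (q : {poly int}) :
  n.-primitive_root z -> root (map_poly intr q) z -> 'Phi_n %| q.
Proof.
move=> prim_z qz0; have QtoCE (r : {poly int}) :
    map_poly ratr (map_poly intr r : {poly rat}) = map_poly intr r :> {poly algC}.
  by rewrite -map_poly_comp; apply: eq_map_poly => c /=; rewrite ratr_int.
have [p [Dp _] dv_p] := minCpolyP z; rewrite -dvdp_rat_int -[X in X %| _](_ : p = _).
  by rewrite -dv_p QtoCE.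
apply: (map_poly_inj (ratr : rat -> algC)); rewrite -Dp QtoCE (minCpoly_cyclotomic prim_z).
by rewrite (Cintr_Cyclotomic prim_z).
Qed.

(* The degree of [subset_sum_poly I s] is at most that of the irreducible ['Phi_l],
   so a common root would make them proportional; but the coefficients of the
   former in degrees 1, ..., l - 1 are not all equal. *)
Lemma resultant_subset_sum_neq0 (l : nat) (I : {set 'I_l.-1}) (s : int) :
  prime l -> I != set0 -> I != setT ->
  resultant 'Phi_l (subset_sum_poly I s) != 0.
Proof.
move=> pr_l nzI nTI; set g := subset_sum_poly I s.
rewrite resultant_eq0 -leqNgt; set h := Pdiv.Idomain.gcdp _ _.
have [hPhi hg] : h %| 'Phi_l /\ h %| g by rewrite dvdp_gcdl dvdp_gcdr.
have ZtoC_inj := intr_inj : injective (intr : int -> algC).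
rewrite leqNgt; apply: contraL isT => h_gt1.
have [z hz] : exists z : algC, root (map_poly intr h) z.
  by apply/closed_rootP; rewrite size_map_inj_poly // gtn_eqF.
have root_dvd (q : {poly int}) : h %| q -> root (map_poly intr q : {poly algC}) z.
  case/Pdiv.Idomain.dvdpP=> [[c r]] /= nz_c /(congr1 (map_poly (intr : int -> algC))).
  rewrite map_polyZ rmorphM /= => Dq.
  by rewrite -(@rootZ _ _ c%:~R) ?intr_eq0 // Dq rootM hz orbT.
have [w prim_w] := C_prim_root_exists (prime_gt0 pr_l).
have prim_z : l.-primitive_root z.
  by rewrite -(root_cyclotomic prim_w) -(Cintr_Cyclotomic prim_w) root_dvd.
(* Divisibility in [{poly int}] is only up to a nonzero scalar, whence the factor [c]. *)
have /Pdiv.Idomain.dvdpP[[c r] /= nz_c Dg] := Cyclotomic_dvdp_root prim_z (root_dvd g hg).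
have n_l : l.-1.+1 = l by rewrite prednK ?prime_gt0.
have r_le1 : (size r <= 1)%N.
  have [->|nz_r] := eqVneq r 0; first by rewrite size_poly0.
  have := leq_trans (eq_leq (size_scale g nz_c)) (size_subset_sum_poly I s).
  rewrite Dg size_Mmonic ?Cyclotomic_monic // size_Cyclotomic_prime //.
  by move: n_l; lia.
have coef_eq (i : 'I_l.-1) : c * - (i \in I)%:R = r`_0.
  have := congr1 (fun q : {poly int} => q`_i.+1) Dg.
  rewrite coefZ coefS_subset_sum_poly => ->.
  rewrite (size1_polyC r_le1) coefCM coefC coef_Cyclotomic_prime //.
  by rewrite -[X in (_ < X)%N]n_l ltnS ltn_ord mulr1.
have [i iI] := set0Pn _ nzI.
have [j jI] : exists j, j \notin I.
  by apply/existsP; rewrite -negb_forall; apply: contra nTI => /forallP IT; apply/eqP/setP => j; rewrite IT inE.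
have := coef_eq j; rewrite -(coef_eq i) iI (negPf jI) oppr0 mulr0 mulrN1.
by move/esym/eqP; rewrite oppr_eq0 (negPf nz_c).
Qed.

(** * Reduction modulo p *)

Lemma root_Cyclotomic_primitive (F : fieldType) (l : nat) (z : F) :
  prime l -> l%:R != 0 :> F -> root (map_poly intr 'Phi_l) z -> l.-primitive_root z.
Proof.
move=> pr_l nz_l /rootP; rewrite horner_map_Cyclotomic_prime // => z0.
have zl : z ^+ l = 1 by apply/eqP; rewrite -subr_eq0 subrX1 z0 mulr0.
have [m prim_m /(prime_nt_dvdP pr_l) m_l] := prim_order_exists (prime_gt0 pr_l) zl.
have [m1|/m_l <- //] := eqVneq m 1%N.
(* Otherwise z = 1, and the value l of the polynomial at 1 would vanish in [F]. *)
move: nz_l; rewrite m1 in prim_m; rewrite (prim_expr_order prim_m : z = 1) in z0.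
by move: z0; under eq_bigr do rewrite expr1n; rewrite sumr_const card_ord => ->; rewrite eqxx.
Qed.

Lemma Cyclotomic_prime_factor (F : fieldType) (l : nat) (z : F) :
  prime l -> l.-primitive_root z ->
  map_poly intr 'Phi_l = \prod_(i < l.-1) ('X - (z ^+ i.+1)%:P).
Proof.
move=> pr_l prim_z; apply: (@mulfI _ ('X - 1)); first by rewrite -size_poly_eq0 size_XsubC.
rewrite Cyclotomic_prime // raddf_sum /=; under eq_bigr do rewrite map_polyXn.
rewrite -subrX1 -(factor_Xn_sub_1 prim_z) -[X in \prod_(0 <= i < X) _](prednK (prime_gt0 pr_l)).
by rewrite big_nat_recl // expr0 big_mkord.
Qed.

(** Modulo p the term [m] disappears, so the roots of [A] are some of the powers of z = d, and [I]
    records which ones. The strict bounds on [size A] make [I] nonempty and proper. *)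
Lemma dvdn_resultant_subset_sum (l p : nat) (m d : int) (A B : {poly int}) :
  prime l -> prime p -> p != l -> (p %| PhiZ l d)%Z -> (p %| m)%Z ->
  'Phi_l - m%:P = A * B -> A \is monic -> (1 < size A < l)%N ->
  exists I : {set 'I_l.-1}, [/\ I != set0, I != setT &
    (p %| resultant 'Phi_l (subset_sum_poly I (- A`_(size A).-2)))%Z].
Proof.
move=> pr_l pr_p p_l p_d p_m defAB monA /andP[A_gt1 A_lt].
have chp := pchar_Fp pr_p.
set z : 'F_p := d%:~R.
have Phiz : root (map_poly intr 'Phi_l) z.
  by rewrite rootE horner_map -(dvdz_pcharf chp).
have prim_z : l.-primitive_root z.
  apply: root_Cyclotomic_primitive => //.
  by rewrite -(dvdn_pcharf chp) dvdn_prime2.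
have szA : size (map_poly intr A : {poly 'F_p}) = size A.
  by rewrite size_map_poly_id0 // (monicP monA) rmorph1 oner_eq0.
have /dvdp_prod_XsubC[b] :
    map_poly intr A %| \prod_(i <- enum 'I_l.-1) ('X - (z ^+ i.+1)%:P).
  rewrite big_enum -Cyclotomic_prime_factor //.
  apply/dvdpP; exists (map_poly intr B); rewrite mulrC -rmorphM -defAB rmorphB /=.
  rewrite map_polyC /=; have /eqP-> : m%:~R == 0 :> 'F_p by rewrite -(dvdz_pcharf chp).
  by rewrite subr0.
rewrite eqp_monic ?monic_map ?monic_prod_XsubC // => /eqP defA.
pose I := [set i in mask b (enum 'I_l.-1)].
have uniq_b : uniq (mask b (enum 'I_l.-1)) by rewrite mask_uniq ?enum_uniq.
have cardI : (#|I|).+1 = size A.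
  by rewrite -szA defA size_prod_XsubC cardsE (card_uniqP uniq_b).
have sumI : (- A`_(size A).-2)%:~R = \sum_(i in I) z ^+ i.+1 :> 'F_p.
  rewrite rmorphN /= -coef_map defA.
  set s := mask _ _; pose t := [seq z ^+ (i : 'I_l.-1).+1 | i <- s].
  have -> : \prod_(i <- s) ('X - (z ^+ i.+1)%:P) = \prod_(x <- t) ('X - x%:P) by rewrite big_map.
  have sz_t : (size t).+1 = size A.
    by rewrite size_map -cardI cardsE (card_uniqP uniq_b).
  have -> : (size A).-2 = (size t).-1 by rewrite -sz_t.
  rewrite coefPn_prod_XsubC; last by rewrite -lt0n -ltnS sz_t.
  rewrite opprK.
  by rewrite big_map big_uniq //=; apply: eq_bigl => i; rewrite inE.
exists I; split.
- by rewrite -card_gt0 -ltnS cardI.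
- apply: contraTneq A_lt => IT; rewrite -cardI IT cardsT card_ord.
  by rewrite prednK ?prime_gt0 // ltnn.
set g := subset_sum_poly _ _.
(* The resultant is a combination of ['Phi_l] and [g] over the integer polynomials, and both vanish
   at [z] modulo p. *)
have [||[u v] _ Duv] := @resultant_in_ideal _ 'Phi_l g.
- by rewrite size_Cyclotomic_prime ?prime_gt1.
- have [i iI] : exists i, i \in I by apply/set0Pn; rewrite -card_gt0 -ltnS cardI.
  rewrite ltnNge; apply/negP => /size1_polyC /(congr1 (fun q : {poly int} => q`_i.+1)).
  by rewrite coefC coefS_subset_sum_poly iI.
rewrite (dvdz_pcharf chp); apply/eqP.
have /(congr1 (fun q : {poly int} => (map_poly intr q).[z])) := Duv.
rewrite map_polyC hornerC /= => ->.
rewrite rmorphD !rmorphM hornerD !hornerM /= (rootP Phiz) mulr0 add0r.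
rewrite [X in _ * X](_ : _ = 0) ?mulr0 // rmorphB rmorph_sum /= map_polyC hornerD hornerN hornerC /= horner_sum.
by under eq_bigr do rewrite map_polyXn hornerXn; rewrite sumI subrr.
Qed.

(** * Size of roots and of subleading coefficients *)

Lemma root_Cyclotomic_sub_bound (l : nat) (m : int) (c : nat) (z : algC) :
  prime l -> (1 < c)%N -> `|m| <= (c ^ l.-1)%N%:Z ->
  root (map_poly intr ('Phi_l - m%:P)) z -> `|z| <= (2 * c)%:R.
Proof.
move=> pr_l c_gt1 m_le /rootP; rewrite rmorphB /= map_polyC hornerD hornerN hornerC /=.
rewrite horner_map_Cyclotomic_prime //.
case: l => [|n] // in pr_l m_le *; have n_gt0 : (0 < n)%N := prime_gt1 pr_l.
rewrite big_ord_recr /= in m_le *.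
move/eqP; rewrite subr_eq0 => /eqP Dm.
have zn : z ^+ n = m%:~R - \sum_(i < n) z ^+ i by rewrite -Dm [X in X - _]addrC addrK.
set r : algC := `|z|; have r_ge0 : 0 <= r by apply: normr_ge0.
have c_le : 3%:R <= (2 * c)%:R :> algC by rewrite ler_nat; lia.
(* For r > 3 the geometric sum of the lower powers is at most r^n / 2, since r - 1 >= 2. Hence r^n
   <= 2 c^n <= (2c)^n. *)
case: (real_leP (normr_real z) (@realn _ 3)) => [/le_trans->//|r_gt3].
rewrite -/r in r_gt3 *.
have sum_le : 2 * (\sum_(i < n) r ^+ i) <= r ^+ n.
  have S_ge0 : 0 <= \sum_(i < n) r ^+ i by apply: sumr_ge0 => i _; apply: exprn_ge0.
  have := subrX1 r n; set S := \sum_(i < n) _ in S_ge0 * => /eqP.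
  rewrite subr_eq => /eqP->; rewrite ler_wpDr // ler_wpM2r // lerBrDr.
  by rewrite natr1 ltW.
have rn_le : r ^+ n <= (c ^ n)%:R + \sum_(i < n) r ^+ i.
  rewrite /r -normrX zn (le_trans (ler_normB _ _)) // lerD //.
    by move: m_le; rewrite -(ler_int algC) intr_norm -pmulrn.
  by rewrite (le_trans (ler_norm_sum _ _ _)) // ler_sum // => i _; rewrite normrX.
have rn_le2 : r ^+ n <= 2 * (c ^ n)%:R.
  rewrite -(lerD2r (r ^+ n)) -[leLHS]mulr2n -[leLHS]mulr_natl.
  apply: le_trans (ler_wpM2l (ler0n _ 2) rn_le) _.
  by rewrite mulrDr lerD2l.
rewrite -(@ler_pXn2r _ n) ?nnegrE ?ler0n // (le_trans rn_le2) //.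
by rewrite -natrM -natrX ler_nat expnMn leq_mul2r -{1}[2%N]expn1 leq_exp2l // n_gt0 orbT.
Qed.

(** Up to sign the coefficient is the sum of the complex roots of [A]. There are fewer than l of
    them, and each is a root of ['Phi_l - m%:P]. *)
Lemma subleading_coef_factor_bound (l : nat) (m : int) (c : nat) (A B : {poly int}) :
  prime l -> (1 < c)%N -> `|m| <= (c ^ l.-1)%N%:Z ->
  'Phi_l - m%:P = A * B -> A \is monic -> (1 < size A <= l)%N ->
  `|A`_(size A).-2| <= (l * (2 * c))%N%:Z.
Proof.
move=> pr_l c_gt1 m_le defAB monA /andP[A_gt1 A_le].
have ZtoC_inj := intr_inj : injective (intr : int -> algC).
have szA : size (map_poly intr A : {poly algC}) = size A by rewrite size_map_inj_poly.
have [s] := closed_field_poly_normal (map_poly intr A : {poly algC}).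
rewrite (monicP (monic_map _ monA)) scale1r => defA.
have sz_s : (size s).+1 = size A by rewrite -szA defA size_prod_XsubC.
have s_le z : z \in s -> `|z| <= (2 * c)%:R.
  move=> zs; apply: (root_Cyclotomic_sub_bound pr_l c_gt1 m_le).
  by rewrite defAB rmorphM /= rootM defA root_prod_XsubC zs.
rewrite -(ler_int algC) intr_norm -coef_map defA.
have -> : (size A).-2 = (size s).-1 by rewrite -sz_s.
rewrite coefPn_prod_XsubC; last by rewrite -lt0n -ltnS sz_s.
rewrite normrN.
apply: le_trans (ler_norm_sum _ _ _) _; rewrite big_seq.
apply: le_trans (ler_sum _ s_le) _; rewrite -big_seq big_const_seq count_predT iter_addr_0.
rewrite -pmulrn -mulrnA ler_nat mulnC leq_mul2r; apply/orP; right.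
by rewrite (leq_trans _ A_le) // -sz_s.
Qed.

(** For n = l - 1 this bounds the value of ['Phi_l] at [x] by a single power. *)
Lemma sum_exprn_le (x n : nat) : (\sum_(i < n.+1) x ^ i <= x.+1 ^ n)%N.
Proof.
elim: n => [|n IHn]; first by rewrite big_ord_recl big_ord0.
rewrite big_ord_recl expn0; under eq_bigr do rewrite lift0 expnS.
rewrite -big_distrr /= expnS mulSn leq_add ?expn_gt0 //.
by rewrite (leq_trans (leq_mul (leqnn x) IHn)).
Qed.

Lemma PhiZ_natE (l d : nat) : prime l -> PhiZ l d%:Z = (\sum_(i < l) d ^ i)%N%:Z.
Proof.
move=> pr_l; rewrite /PhiZ Cyclotomic_prime // horner_sum -[RHS]natz natr_sum.
by apply: eq_bigr => i _; rewrite hornerXn natrX natz.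
Qed.

(** * From non-essential primes to divisors of resultants *)

Lemma monic_factor_of_reducible (F : {poly int}) :
  F \is monic -> (1 < size F)%N -> ~ irreducible_poly (map_poly (intr : int -> rat) F) ->
  exists A B : {poly int}, [/\ F = A * B, A \is monic & (1 < size A < size F)%N].
Proof.
move=> monF F_gt1 redF; have ZtoQ_inj := intr_inj : injective (intr : int -> rat).
have nzF : F != 0 by rewrite monic_neq0.
have szF : size (map_poly (intr : int -> rat) F) = size F by rewrite size_map_inj_poly.
apply: contrapT => noA; apply: redF; split=> [|q q_neq1 q_dvd]; first by rewrite szF.
apply: contrapT => /negP q_neqF; apply: noA.
have [A [a nz_a Dq] [r DF]] := dvdpP_rat_int q_dvd.
have szq : size q = size A by rewrite Dq size_scale // size_map_inj_poly.
have u1 : lead_coef A * lead_coef r = 1 by rewrite -lead_coefM -DF (monicP monF).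
have uA : lead_coef A \is a GRing.unit by apply/unitrPr; exists (lead_coef r).
have uu : lead_coef r * lead_coef A = 1 by rewrite mulrC.
(* Gauss's lemma gave an integral factorization; the leading coefficients are mutually inverse
   units, so exchanging them makes [A] monic. *)
exists (lead_coef r *: A), (lead_coef A *: r); split.
- by rewrite -scalerAl -scalerAr scalerA uu scale1r.
- by rewrite monicE lead_coefZ uu.
have nz_r : lead_coef r != 0 by apply: contra_eq_neq u1 => ->; rewrite mulr0 eq_sym oner_neq0.
rewrite size_scale //.
have nzA : A != 0 by apply: contraNneq nzF => A0; rewrite DF A0 mul0r.
have A_gt1 : (1 < size A)%N.
  by rewrite ltn_neqAle eq_sym -szq q_neq1 szq lt0n size_poly_eq0.
rewrite A_gt1 ltn_neqAle -szq -szF dvdp_size_eqp // q_neqF szq szF.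
rewrite lead_coef_eq0 in nz_r; rewrite DF size_mul // -ltnS prednK ?addn_gt0 ?size_poly_gt0 ?nzA //.
by rewrite -[ltnLHS]addn0 ltn_add2l size_poly_gt0.
Qed.

(** Since p^(2/l) <= b, the failing constant satisfies |cp| < Phi(b) <= (b + 1)^(l - 1), so the root
    bound applies with [b.+1]. *)
Lemma nonessential_dvdn_resultant (l p b : nat) (d : int) :
  prime l -> prime p -> p != l -> (p %| PhiZ l d)%Z -> ~ essential l p ->
  (0 < b)%N -> (p%:R : R) `^ (2 / l%:R) <= b%:R ->
  exists (I : {set 'I_l.-1}) (s : int), [/\ I != set0, I != setT,
    `|s| <= (l * (2 * b.+1))%N%:Z & (p %| resultant 'Phi_l (subset_sum_poly I s))%Z].
Proof.
move=> pr_l pr_p p_l p_d /existsNP[c /not_implyP[c_lt redPhi]] b_gt0 p_le.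
set m := c * p%:Z in c_lt redPhi.
have l_gt1 := prime_gt1 pr_l.
have sz_lt : (size (- m%:P : {poly int}) < size 'Phi_l)%N.
  by rewrite size_polyN size_Cyclotomic_prime // (leq_ltn_trans (size_polyC_leq1 _)).
have szF : size ('Phi_l - m%:P) = l by rewrite size_polyDl // size_Cyclotomic_prime.
have monF : 'Phi_l - m%:P \is monic.
  by rewrite monicE lead_coefDl // (monicP (Cyclotomic_monic l)).
have [||A [B [defAB monA szA]]] := @monic_factor_of_reducible _ monF.
- by rewrite szF.
- by rewrite rmorphB /= map_polyC.
rewrite szF in szA.
have p_m : (p %| m)%Z by rewrite dvdz_mull.
have [I [I0 IT p_res]] := dvdn_resultant_subset_sum pr_l pr_p p_l p_d p_m defAB monA szA.
exists I, (- A`_(size A).-2); split=> //; rewrite normrN.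
apply: (subleading_coef_factor_bound pr_l _ _ defAB monA); last by lia.
  by rewrite ltnS.
rewrite -(ler_int R) intr_norm (le_trans (ltW c_lt)) //.
rewrite /PhiR horner_map_Cyclotomic_prime //.
apply: (@le_trans _ _ (\sum_(i < l) (b ^ i)%:R)).
  apply: ler_sum => i _; rewrite natrX lerXn2r ?nnegrE ?powR_ge0 ?ler0n //.
rewrite -natr_sum -pmulrn ler_nat.
by case: l l_gt1 {pr_l p_l p_d p_le sz_lt szF monF szA defAB p_res I I0 IT c_lt redPhi} => // n _; apply: sum_exprn_le.
Qed.

(** * Counting primes *)

Lemma card_prime_divisors_le (N t w M : nat) (P : {set 'I_N}) :
  (0 < t)%N -> (0 < M)%N -> (M ^ 2 < t ^ w.+1)%N ->
  {in P, forall p : 'I_N, [/\ prime p, (p %| M)%N & (t <= p ^ 2)%N]} -> (#|P| <= w)%N.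
Proof.
move=> t_gt0 M_gt0 M_lt hP; rewrite leqNgt; apply: contraL M_lt => w_lt.
rewrite -leqNgt (leq_trans (leq_pexp2l t_gt0 w_lt)) // -prod_nat_const.
apply: (@leq_trans (\prod_(p in P) p ^ 2)); first by apply: leq_prod => p /hP[].
rewrite -(big_morph (fun n => n ^ 2)%N (fun x y => expnMn x y 2) (exp1n 2)) leq_sqr.
have -> : (\prod_(p in P) p = \prod_(p <- map val (enum P)) p)%N by rewrite big_map big_enum.
rewrite dvdn_leq //.
apply: prod_primes_dvdn => [|q /mapP[p + ->]]; first by rewrite map_inj_uniq ?enum_uniq //; apply: val_inj.
by rewrite mem_enum => /hP[? ? _].
Qed.

Lemma card_prime_divisors_family_le (N t w : nat) (J : finType) (M : J -> nat)
    (P : {set 'I_N}) : (0 < t)%N ->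
  {in P, forall p : 'I_N, [/\ prime p, (t <= p ^ 2)%N &
    exists2 j, (0 < M j)%N /\ (M j ^ 2 < t ^ w.+1)%N & (p %| M j)%N]} ->
  (#|P| <= #|J| * w)%N.
Proof.
move=> t_gt0 hP; pose C j := [set p in P | [&& (0 < M j)%N, (M j ^ 2 < t ^ w.+1)%N & (p %| M j)%N]].
have /subset_leq_card/leq_trans-> // : P \subset \bigcup_j C j.
  apply/subsetP => p pP; have [_ _ [j [M0 Mt] pM]] := hP p pP.
  by apply/bigcupP; exists j; rewrite ?inE ?pP ?M0 ?Mt.
rewrite -sum_nat_const.
elim/big_ind2: _ => [|n A m B A_le B_le|j _]; first by rewrite cards0.
  by rewrite (leq_trans (leq_card_setU A B)) // leq_add.
have [->|[p]] := set_0Vmem (C j); first by rewrite cards0.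
rewrite inE => /andP[_ /and3P[M0 Mt _]].
apply: (card_prime_divisors_le t_gt0 M0 Mt) => q; rewrite inE => /andP[qP /and3P[_ _ qM]].
by have [] := hP q qP.
Qed.

Lemma resultant_subset_sum_bound (l S : nat) (I : {set 'I_l.-1}) (s : int) :
  prime l -> `|s| <= S%:Z ->
  (`|resultant 'Phi_l (subset_sum_poly I s)| <= (2 * l)`! * S.+1 ^ (2 * l))%N.
Proof.
move=> pr_l s_le; set g := subset_sum_poly I s.
have := @resultant_coef_bound 'Phi_l g S.+1.
rewrite -abszE => /(_ _ _)/le_trans le_res; rewrite -lez_nat; apply: le_res.
- by move=> i; rewrite coef_Cyclotomic_prime //; case: (_ < _)%N.
- move=> i; apply: le_trans (subset_sum_poly_coef_bound I s i) _.
  by rewrite lez_nat ltnS -lez_nat abszE.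
have N_le : ((size g).-1 + (size 'Phi_l).-1 <= 2 * l)%N.
  have := size_subset_sum_poly I s; rewrite -/g size_Cyclotomic_prime //.
  by have := prime_gt0 pr_l; lia.
by rewrite lez_nat leq_mul ?leq_pexp2l ?leq_fact.
Qed.

(** Encodes the integers of [-S, S] as ordinals below 2S + 1, so that the pairs (I, s) form a
    [finType]. *)
Lemma absz_shift_bound (s : int) (S : nat) : `|s| <= S%:Z ->
  (absz (s + S%:Z)%R < (2 * S).+1)%N /\ (absz (s + S%:Z)%R)%:Z - S%:Z = s.
Proof. lia. Qed.

(** There are 2^(l-1) (2S + 1) pairs (I, s), each accounting for at most 4l primes. Here [b] bounds
    the integer part of p^(2/l), so [b.+1] bounds p^(2/l) and the root bound uses [b.+2]. The
    condition l^2 < t excludes p = l. *)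
Lemma card_nonessential_le (l t b N : nat) (P : {set 'I_N}) :
  let S := (l * (2 * b.+2))%N in
  prime l -> (l ^ 2 < t)%N -> ((2 * l)`! ^ 2 < t)%N -> (S < t)%N ->
  (forall k, k ^ l <= t.+1 ^ l.-1 -> k <= b)%N ->
  {in P, forall p : 'I_N, [/\ prime p, ~ essential l p, (t <= p ^ 2)%N &
    exists2 d, (0 < d <= t)%N & ((p ^ 2)%N %| PhiZ l d%:Z)%Z]} ->
  (#|P| <= 2 ^ l.-1 * (2 * S).+1 * (4 * l))%N.
Proof.
move=> S pr_l l_lt fact_lt S_lt b_max hP; have t_gt0 : (0 < t)%N by apply: leq_trans S_lt.
have -> : (2 ^ l.-1 * (2 * S).+1 = #|{: {set 'I_l.-1} * 'I_(2 * S).+1}|)%N.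
  by rewrite card_prod card_ord -(cardsT {set _}) -powersetT card_powerset cardsT card_ord.
pose M (j : {set 'I_l.-1} * 'I_(2 * S).+1) :=
  `|resultant 'Phi_l (subset_sum_poly j.1 (j.2%:Z - S%:Z))|%N.
apply: (@card_prime_divisors_family_le _ t _ _ M) => // p pP.
have [pr_p ness t_le [d /andP[d_gt0 d_le] p2_d]] := hP p pP; split=> //.
have p_l : p != l :> nat.
  by apply: contraTneq l_lt => <-; rewrite -leqNgt.
have p_d : (p %| PhiZ l d%:Z)%Z by apply: dvdz_trans p2_d; rewrite PoszM dvdz_mulr.
set x : R := p%:R `^ (2 / l%:R).
have x_ge0 : 0 <= x by apply: powR_ge0.
have /andP[k_le k_gt] := truncn_itv x_ge0; set k := Num.truncn x in k_le k_gt.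
have k_leb : (k <= b)%N.
  (* k^l <= x^l = p^2 <= Phi(d) <= (d + 1)^(l - 1) <= (t + 1)^(l - 1). *)
  apply: b_max; rewrite -(ler_nat R) natrX.
  apply: (@le_trans _ _ (x ^+ l)); first by rewrite lerXn2r ?nnegrE ?ler0n.
  rewrite -powR_mulrn // -powRrM divfK ?pnatr_eq0 -?lt0n ?prime_gt0 //.
  rewrite powR_mulrn ?ler0n // -natrX ler_nat.
  have Phi_gt0 : (0 < \sum_(i < l) d ^ i)%N.
    by rewrite -(prednK (prime_gt0 pr_l)) big_ord_recl.
  rewrite PhiZ_natE // /dvdz /= in p2_d.
  apply: leq_trans (dvdn_leq Phi_gt0 p2_d) _.
  have := sum_exprn_le d l.-1; rewrite prednK ?prime_gt0 // => /leq_trans; apply.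
  by rewrite leq_exp2r ?ltnS // -ltnS prednK ?prime_gt0 ?prime_gt1.
have [I [s [I0 IT s_le p_res]]] :=
  nonessential_dvdn_resultant (b := k.+1) pr_l pr_p p_l p_d ness isT (ltW k_gt).
have {}s_le : `|s| <= S%:Z.
  by apply: le_trans s_le _; rewrite lez_nat !leq_mul2l !ltnS k_leb !orbT.
have [j_lt Ds] := absz_shift_bound s_le.
pose j : {set 'I_l.-1} * 'I_(2 * S).+1 := (I, Ordinal j_lt).
have Mj : M j = `|resultant 'Phi_l (subset_sum_poly I s)|%N by rewrite /M /= Ds.
exists j; rewrite Mj //.
split; first by rewrite absz_gt0 resultant_subset_sum_neq0.
have := resultant_subset_sum_bound I pr_l s_le; rewrite -(leq_sqr `|_|).
move=> /leq_ltn_trans -> //; rewrite expnMn [ltnRHS]expnS.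
(* As S + 1 <= t, the squared resultant is at most (2l)!^2 t^(4l) < t^(4l+1), which fixes the
   exponent 4l. *)
apply: leq_ltn_trans (_ : (2 * l)`! ^ 2 * t ^ (4 * l) < _)%N; last first.
  by rewrite ltn_pmul2r // expn_gt0 t_gt0.
rewrite leq_pmul2l ?expn_gt0 ?fact_gt0 // -expnM.
by rewrite (_ : (2 * l * 2 = 4 * l)%N) ?leq_exp2r ?muln_gt0 ?(prime_gt0 pr_l) //; ring.
Qed.

Lemma card_small_squares_le (t q N : nat) (P : {set 'I_N}) :
  (forall k, k ^ 2 <= t -> k <= q)%N -> {in P, forall p : 'I_N, (p ^ 2 <= t)%N} ->
  (#|P| <= q.+1)%N.
Proof.
move=> q_max P_le; rewrite cardE -(size_map val) -(size_iota 0 q.+1).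
apply: uniq_leq_size; first by rewrite map_inj_uniq ?enum_uniq //; apply: val_inj.
by move=> k /mapP[p]; rewrite mem_enum => /P_le/q_max p_le ->; rewrite mem_iota.
Qed.

(** * Asymptotic estimates and conclusion *)

Lemma power_le_linear (e : R) (n : nat) : 0 < e ->
  exists T0 : R, forall T, T0 <= T -> forall k : nat,
    (k ^ n.+1 <= (Num.truncn T).+1 ^ n)%N -> k%:R <= e * T.
Proof.
move=> e_gt0; exists (1 + 2 ^+ n / e ^+ n.+1) => T T_ge k k_le.
have c_gt0 : 0 < 2 ^+ n / e ^+ n.+1 by rewrite divr_gt0 ?exprn_gt0.
have T_ge1 : 1 <= T by lra.
have T_gt : 2 ^+ n / e ^+ n.+1 < T by lra.
have eT_ge0 : 0 <= e * T by rewrite mulr_ge0; lra.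
have t_le : (Num.truncn T).+1%:R <= 2 * T.
  have /andP[+ _] := @truncn_itv R T ltac:(lra).
  by rewrite -natr1; lra.
rewrite -(@ler_pXn2r _ n.+1) ?nnegrE ?ler0n //.
apply: (@le_trans _ _ ((2 * T) ^+ n)).
  apply: (@le_trans _ _ ((Num.truncn T).+1%:R ^+ n)); first by rewrite -!natrX ler_nat.
  by rewrite lerXn2r ?nnegrE ?ler0n //; lra.
rewrite !exprMn [T ^+ n.+1]exprS mulrA ler_wpM2r ?exprn_ge0 //; first by lra.
by rewrite mulrC -ler_pdivrMr ?exprn_gt0 // ltW.
Qed.

(** A [d] that works for p^j works for p^i, so the least one for p^i is no larger. This places the
    essential primes of S^2 in S^1. *)
Lemma in_S_le (i j l p : nat) (T : R) : (i <= j)%N -> in_S j l T p -> in_S i l T p.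
Proof.
move=> le_ij [pr_p [d [[d_gt0 [p_d _]] d_le]]]; split=> //.
have p_d' : (p ^ i %| absz (PhiZ l d%:Z))%N by apply: dvdn_trans p_d; apply: dvdn_exp2l.
have ex_d : exists k, (0 < k)%N && (p ^ i %| absz (PhiZ l k%:Z))%N.
  by exists d; rewrite d_gt0.
case: (ex_minnP ex_d) => m /andP[m_gt0 p_m] m_min; exists m; split.
  split=> //; split=> // k k_gt0 k_lt p_k.
  by have := m_min k; rewrite k_gt0 leqNgt k_lt => /(_ p_k).
by rewrite (le_trans _ d_le) // ler_nat m_min // d_gt0.
Qed.

Lemma count_S2_le (l t b q : nat) (T : R) :
  let S := (l * (2 * b.+2))%N in
  t = Num.truncn T -> 0 <= T ->
  prime l -> (l ^ 2 < t)%N -> ((2 * l)`! ^ 2 < t)%N -> (S < t)%N ->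
  (forall k, k ^ l <= t.+1 ^ l.-1 -> k <= b)%N ->
  (forall k, k ^ 2 <= t -> k <= q)%N ->
  (count_S 2 l T (fun _ => True) <=
     count_S 1 l T (essential l) + (q.+1 + 2 ^ l.-1 * (2 * S).+1 * (4 * l)))%N.
Proof.
move=> S Dt T_ge0 pr_l l_lt fact_lt S_lt b_max q_max.
pose Q := [set p : 'I_(S_bound l T) | (p ^ 2 <= t)%N].
pose P := [set p : 'I_(S_bound l T) |
  [&& `[< in_S 2 l T p >], ~~ `[< essential l p >] & (t <= p ^ 2)%N]].
have Q_le : (#|Q| <= q.+1)%N.
  by apply: (card_small_squares_le q_max) => p; rewrite inE.
have P_le : (#|P| <= 2 ^ l.-1 * (2 * S).+1 * (4 * l))%N.
  apply: (card_nonessential_le pr_l l_lt fact_lt S_lt b_max) => p.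
  rewrite inE => /and3P[/asboolP[pr_p [d [[d_gt0 [p2_d _]] d_le]]] /asboolP ness t_le].
  by split=> //; exists d; rewrite // d_gt0 Dt truncn_ge_nat.
apply: leq_trans (leq_add (leqnn _) (leq_add Q_le P_le)).
have card_sum (A : {set 'I_(S_bound l T)}) : #|A| = (\sum_p (p \in A))%N.
  by rewrite -sum1_card big_mkcond; apply: eq_bigr => p _; case: ifP.
(* All counts are sums of indicators over the same range [S_bound l T], so it suffices to compare
   them prime by prime. *)
rewrite !card_sum /count_S -!big_split; apply: leq_sum => p _ /=.
rewrite !inE; case: asboolP => [[Sp _]|//] /=.
case: asboolP => //= nSE; rewrite (asboolT Sp) /=.
case: asboolP => [ess|_] /=; first by case: nSE; split=> //; apply: in_S_le Sp.
by case: (leqP (p ^ 2) t) => // /ltnW ->.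
Qed.

Unset Implicit Arguments.

Theorem theorem4 (l : nat) (hl : prime l) (hodd : odd l)
  (H : little_o_T (fun T => (count_S 1 l T (essential l))%:R)) :
  little_o_T (fun T => (count_S 2 l T (fun _ => True))%:R).
Proof.
move=> eps eps_gt0.
have l_gt0 := prime_gt0 hl.
have l_ge1 : 1 <= l%:R :> R by rewrite ler1n.
pose C : R := (2 ^ l.-1 * (4 * l))%:R.
have C_gt0 : 0 < C by rewrite ltr0n !muln_gt0 expn_gt0 l_gt0.
(* The first bound on [e] keeps the main term of the pair count below eps T / 6; the second gives
   2lb <= T / 2, which leaves room for S < t. *)
pose e := Num.min (eps / (24 * C * l%:R)) (1 / (4 * l%:R)).
have e_gt0 : 0 < e by rewrite lt_min !divr_gt0 ?mulr_gt0 //; lra.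
have e_le1 : C * (4 * l%:R * e) <= eps / 6.
  have : e <= eps / (24 * C * l%:R) by rewrite ge_min lexx.
  rewrite ler_pdivlMr ?mulr_gt0 //; last by lra.
  by nra.
have e_le2 : 2 * l%:R * e <= 1 / 2.
  have : e <= 1 / (4 * l%:R) by rewrite ge_min lexx orbT.
  rewrite ler_pdivlMr ?mulr_gt0 //; last by lra.
  by nra.
have eps3 : 0 < eps / 3 by lra.
have eps6 : 0 < eps / 6 by lra.
have [T1 HT1] := H _ eps3.
have [T2 HT2] := power_le_linear l.-1 e_gt0.
have [T3 HT3] := power_le_linear 1 eps6.
(* Budget: eps / 3 for the essential primes, and eps / 6 each for the small primes, the term linear
   in [b], and the constants, which [T4] absorbs. *)
pose T4 : R := 6 / eps * (1 + C * (8 * l%:R + 1)).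
exists (Num.max T1 (Num.max T2 (Num.max T3 (Num.max T4
  (((l ^ 2).+1 + ((2 * l)`! ^ 2).+1)%:R + 2 * (4 * l%:R + 1)))))) => T.
rewrite !ge_max => /and5P[/HT1 ess_le /HT2 b_max /HT3 q_max T4_le T5_le].
have T_ge0 : 0 <= T by apply: le_trans T5_le; rewrite addr_ge0 ?ler0n // mulr_ge0; lra.
have eT_ge0 : 0 <= e * T by rewrite mulr_ge0 // ltW.
have epsT_ge0 : 0 <= eps / 6 * T by rewrite mulr_ge0 // ltW.
have b_le := truncn_le (e * T); rewrite eT_ge0 in b_le.
have q_le := truncn_le (eps / 6 * T); rewrite epsT_ge0 in q_le.
set b := Num.truncn (e * T) in b_le; set q := Num.truncn (eps / 6 * T) in q_le.
rewrite ger0_norm ?ler0n // in ess_le; rewrite ger0_norm ?ler0n //.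
have := @count_S2_le l (Num.truncn T) b q T erefl T_ge0 hl.
rewrite natrD in T5_le.
have lsq_ge0 : 0 <= (l ^ 2).+1%:R :> R by apply: ler0n.
have fact_ge0 : 0 <= ((2 * l)`! ^ 2).+1%:R :> R by apply: ler0n.
have bT : 2 * l%:R * b%:R <= 1 / 2 * T by nra.
have l_lt : (l ^ 2 < Num.truncn T)%N by rewrite truncn_gt_nat; lra.
have fact_lt : ((2 * l)`! ^ 2 < Num.truncn T)%N by rewrite truncn_gt_nat; lra.
have S_lt : (l * (2 * b.+2) < Num.truncn T)%N.
  rewrite truncn_gt_nat -natr1 !natrM -[b.+2%:R]natr1 -[b.+1%:R]natr1; lra.
have b_max' k : (k ^ l <= (Num.truncn T).+1 ^ l.-1 -> k <= b)%N.
  by move=> k_le; rewrite truncn_ge_nat // b_max // prednK.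
have q_max' k : (k ^ 2 <= Num.truncn T -> k <= q)%N.
  by move=> k_le; rewrite truncn_ge_nat // q_max // expn1 (leq_trans k_le).
move=> /(_ l_lt fact_lt S_lt b_max' q_max'); rewrite -(ler_nat R) !natrD => /le_trans; apply.
(* With S = 2l(b + 2), the factor 2S + 1 is 4lb + (8l + 1). *)
have -> : (2 ^ l.-1 * (2 * (l * (2 * b.+2))).+1 * (4 * l))%:R =
    C * (4 * l%:R * b%:R + (8 * l%:R + 1)) :> R.
  rewrite /C -!natrM natr1 -natrD -natrM; congr (_%:R).
  by rewrite mulnAC; congr (_ * _)%N; rewrite -[b.+2]addn2 -[LHS]addn1 -[(8 * l).+1]addn1; ring.
rewrite -[q.+1%:R]natr1.
have bC : C * (4 * l%:R * b%:R) <= eps / 6 * T.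
  have := ler_wpM2r T_ge0 e_le1; apply: le_trans.
  by rewrite -!mulrA ler_pM2l // !ler_wpM2l ?ler0n.
have T4_le' : 1 + C * (8 * l%:R + 1) <= eps / 6 * T.
  by move: T4_le; rewrite /T4 mulrAC ler_pdivrMr //; lra.
lra.
Qed.
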